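(* Let $(M,F)$ be a connected complex Randers space, $F=\alpha+|\beta|$. Then $(M,F)$ is a complex Berwald space if and only if it is both generalized Berwald and weakly Kähler.
   Context: Let $M$ be a complex manifold of dimension $n$, $T'M$ its holomorphic tangent bundle with local coordinates $(z^k,\eta^k)$. Let $a_{i\bar j}(z)dz^i\otimes d\bar z^j$ be a Hermitian metric on $M$ (a purely Hermitian metric) and $b=b_i(z)dz^i$ a differential $(1,0)$-form; set $\alpha(z,\eta)=\sqrt{a_{i\bar j}(z)\eta^i\bar\eta^j}$, $\beta(z,\eta)=b_i(z)\eta^i$. A complex Randers space is $(M,F)$ with $F=\alpha+|\beta|$ a complex Finsler metric: with $L:=F^2$, $F$ continuous, $F(z,\eta)\ge 0$ with equality iff $\eta=0$, $F(z,\lambda\eta)=|\lambda|F(z,\eta)$ for $\lambda\in\mathbb C$, $L$ smooth and $g_{i\bar j}:=\partial^2L/\partial\eta^i\partial\bar\eta^j$ a positive definite Hermitian matrix. Since $|\beta|$ is not differentiable where $\beta=0$, smoothness and all differential quantities and identities are understood on the open set of $(z,\eta)$, $\eta\ne0$, where $\beta(z,\eta)\neq0$. Notation: $(g^{\bar ji})$ is the inverse matrix of $(g_{i\bar j})$; $\dot\partial_k=\partial/\partial\eta^k$; summation convention. Chern–Finsler coefficients: $N^i_j:=g^{\bar mi}\frac{\partial g_{l\bar m}}{\partial z^j}\eta^l$, $L^i_{jk}:=\dot\partial_jN^i_k$. Spray coefficients $G^i:=\tfrac12N^i_j\eta^j$. Berwald coefficients $\overset{B}{L}{}^i_{jk}:=\dot\partial_k\dot\partial_jG^i$.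 Put $T^i_{jk}:=L^i_{jk}-L^i_{kj}$. The space is Kähler if $T^i_{jk}\eta^j=0$; weakly Kähler if $g_{i\bar l}T^i_{jk}\eta^j\bar\eta^l=0$; complex Berwald if it is Kähler and the $L^i_{jk}$ depend only on $z$; generalized Berwald if the $\overset{B}{L}{}^i_{jk}$ depend only on $z$. *)

(* Defs.v *)
From HB Require Import structures.
From mathcomp Require Import all_boot all_order all_algebra.
From mathcomp Require Import complex.
From mathcomp Require Import all_classical all_reals all_analysis.
Set Implicit Arguments.
Unset Strict Implicit.
Unset Printing Implicit Defensive.
Import Order.TTheory GRing.Theory Num.Theory.
Import numFieldNormedType.Exports.

Local Open Scope classical_set_scope.
Local Open Scope sesquilinear_scope.
Local Open Scope complex_scope.
Local Open Scope ring_scope.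

(* [R[i]] only carries its topology through its [numFieldType] structure, so
   the topologies on C and C^n are selected by typing functions and sets over
   [R[i]^o] and over the following [normedModType]s; their carriers are
   convertible to ['rV[R[i]]_n] and ['rV[R[i]]_n * 'rV[R[i]]_n]. *)
Definition Cn (R : realType) (n : nat) : normedModType R[i] := 'rV[R[i]]_n.
Definition CnxCn (R : realType) (n : nat) : normedModType R[i] :=
  ('rV[R[i]]_n * 'rV[R[i]]_n)%type.

Section Calculus.
Context {R : realType} {V : normedModType R[i]}.
Implicit Types (f : V -> R[i]^o) (v x : V) (A : set V).

Definition re_along f v x : R -> R := fun t => complex.Re (f (x + t%:C *: v)).
Definition im_along f v x : R -> R := fun t => complex.Im (f (x + t%:C *: v)).

Definition rderivable f v x : Prop :=
  derivable (re_along f v x) 0 1 /\ derivable (im_along f v x) 0 1.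

Definition rderive v f : V -> R[i]^o :=
  fun x => derive1 (re_along f v x) 0 +i* derive1 (im_along f v x) 0.

(* C^infinity in the real sense: all iterated real directional derivatives
   exist and are continuous on [A]; meant for open [A]. *)
Definition smooth_on A f : Prop :=
  forall (vs : seq V) (x : V), A x ->
    {for x, continuous (foldr rderive f vs)} /\
    forall v, rderivable (foldr rderive f vs) v x.

Definition wirtinger v f : V -> R[i]^o :=
  fun x => (rderive v f x - 'i%C * rderive ('i%C *: v) f x) / 2.
Definition wirtinger_bar v f : V -> R[i]^o :=
  fun x => (rderive v f x + 'i%C * rderive ('i%C *: v) f x) / 2.

End Calculus.

Record chart (R : realType) (n : nat) (M : topologicalType) := Chart {
  chart_dom : set M;
  chart_cod : set (Cn R n);
  chart_map : M -> Cn R n;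
  chart_inv : Cn R n -> M;
  chart_dom_open : open chart_dom;
  chart_cod_open : open chart_cod;
  chart_mapP : forall p, chart_dom p ->
    chart_cod (chart_map p) /\ chart_inv (chart_map p) = p;
  chart_invP : forall z, chart_cod z ->
    chart_dom (chart_inv z) /\ chart_map (chart_inv z) = z;
  chart_map_continuous : {in chart_dom, continuous chart_map};
  chart_inv_continuous : {in chart_cod, continuous chart_inv} }.

(* The part of the coordinate domain of [c] lying over the domain of [d], and
   the change of coordinates from [c] to [d] defined there. *)
Definition overlap (R : realType) (n : nat) (M : topologicalType)
    (c d : chart R n M) : set (Cn R n) :=
  [set z | chart_cod c z /\ chart_dom d (chart_inv c z)].
Definition transition (R : realType) (n : nat) (M : topologicalType)
    (c d : chart R n M) : Cn R n -> Cn R n :=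
  fun z => chart_map d (chart_inv c z).

(* [differentiable] over the field [R[i]] is complex differentiability, hence
   the transition maps are holomorphic. *)
Record complexManifold (R : realType) (n : nat) := ComplexManifold {
  carrier :> topologicalType;
  hausdorff_carrier : hausdorff_space carrier;
  second_countable_carrier : @second_countable carrier;
  chart_index : Type;
  atlas : chart_index -> chart R n carrier;
  atlas_cover : forall p, exists c, chart_dom (atlas c) p;
  atlas_holomorphic : forall c d z, overlap (atlas c) (atlas d) z ->
    differentiable (transition (atlas c) (atlas d)) z }.

(** Tensors on a manifold are given by their components in each chart of the
    atlas.  Tangent vectors are row vectors of components eta^k; the change of
    coordinates from [c] to [d] maps (z, eta) to
    (transition c d z, eta *m jacobian (transition c d) z). *)

Section Tensors.
Context {R : realType} {n : nat}.

Definition transition_jacobian (M : topologicalType) (c d : chart R n M)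
    (z : Cn R n) : 'M[R[i]]_n :=
  jacobian (transition c d : 'rV[R[i]]_n -> 'rV[R[i]]_n) z.

(* The order on [R[i]] makes [0 < x] mean that [x] is real and positive. *)
Definition posdefmx (A : 'M[R[i]]_n) : Prop :=
  A \is hermsymmx /\
  forall v : 'rV[R[i]]_n, v != 0 -> 0 < (v *m A *m v ^t*) 0 0.

Variable M : complexManifold R n.
Local Notation I := (chart_index M).
Local Notation cod c := (chart_cod (atlas (c : I))).
Local Notation ovl c d := (overlap (atlas (c : I)) (atlas (d : I))).
Local Notation trans c d := (transition (atlas (c : I)) (atlas (d : I))).
Local Notation jac c d := (transition_jacobian (atlas (c : I)) (atlas (d : I))).

(* [a c z i j] is a_{i \bar j}(z) in the chart [c]. *)
Record hermitianMetric := HermitianMetric {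
  herm_comp :> I -> Cn R n -> 'M[R[i]]_n;
  herm_smooth : forall c i j, smooth_on (cod c) (fun z => herm_comp c z i j);
  herm_posdef : forall c z, cod c z -> posdefmx (herm_comp c z);
  herm_change : forall c d z, ovl c d z ->
    herm_comp c z =
    jac c d z *m herm_comp d (trans c d z) *m (jac c d z) ^t* }.

Record form10 := Form10 {
  form_comp :> I -> Cn R n -> 'rV[R[i]]_n;
  form_smooth : forall c i, smooth_on (cod c) (fun z => form_comp c z 0 i);
  form_change : forall c d z, ovl c d z ->
    form_comp c z = form_comp d (trans c d z) *m (jac c d z)^T }.

End Tensors.

Section LocalGeometry.
Context {R : realType} {n : nat}.
Implicit Types (f : CnxCn R n -> R[i]^o) (x : CnxCn R n) (i j k l m : 'I_n).

Definition dz k f : CnxCn R n -> R[i]^o :=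
  wirtinger ((delta_mx 0 k, 0) : CnxCn R n) f.
Definition deta k f : CnxCn R n -> R[i]^o :=
  wirtinger ((0, delta_mx 0 k) : CnxCn R n) f.
Definition detabar k f : CnxCn R n -> R[i]^o :=
  wirtinger_bar ((0, delta_mx 0 k) : CnxCn R n) f.

Variable F : CnxCn R n -> R[i]^o.

Definition lagrangian : CnxCn R n -> R[i]^o := fun x => F x ^+ 2.

(* Rows carry the unbarred index, columns the barred one; thus
   g^{\bar m i} is [invmx (metric_tensor x) m i]. *)
Definition metric_tensor x : 'M[R[i]]_n :=
  \matrix_(i, j) deta i (detabar j lagrangian) x.

Definition chern_N i j : CnxCn R n -> R[i]^o := fun x =>
  \sum_m \sum_l
    invmx (metric_tensor x) m i * dz j (fun y => metric_tensor y l m) x * x.2 0 l.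

Definition chern_L i j k : CnxCn R n -> R[i]^o := deta j (chern_N i k).

Definition spray i : CnxCn R n -> R[i]^o := fun x =>
  2^-1 * \sum_j chern_N i j x * x.2 0 j.

Definition berwald_L i j k : CnxCn R n -> R[i]^o := deta k (deta j (spray i)).

Definition torsion i j k : CnxCn R n -> R[i]^o := fun x =>
  chern_L i j k x - chern_L i k j x.

End LocalGeometry.

Section Finsler.
Context {R : realType} {n : nat} (M : complexManifold R n).
Local Notation I := (chart_index M).
Local Notation cod c := (chart_cod (atlas (c : I))).

(* Functions on, and subsets of, the holomorphic tangent bundle, expressed in
   the coordinates (z, eta) of each chart.  [F] and [D] below stand for a
   metric and the open set on which it is smooth. *)
Implicit Types (F : I -> CnxCn R n -> R[i]^o) (D : I -> set (CnxCn R n)).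

Record complex_finsler F D : Prop := ComplexFinsler {
  finsler_change : forall c d (z : Cn R n) (eta : 'rV[R[i]]_n),
    overlap (atlas c) (atlas d) z ->
    F c (z, eta) =
    F d (transition (atlas c) (atlas d) z,
         eta *m transition_jacobian (atlas c) (atlas d) z);
  finsler_continuous : forall c (x : CnxCn R n), cod c x.1 ->
    {for x, continuous (F c)};
  finsler_ge0 : forall c (x : CnxCn R n), cod c x.1 -> 0 <= F c x;
  finsler_eq0 : forall c (z : Cn R n) (eta : 'rV[R[i]]_n), cod c z ->
    F c (z, eta) = 0 <-> eta = 0;
  finsler_homogeneous : forall c (z : Cn R n) (eta : 'rV[R[i]]_n) (l : R[i]),
    cod c z -> F c (z, l *: eta) = `|l| * F c (z, eta);
  finsler_smooth : forall c, smooth_on (D c) (lagrangian (F c));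
  finsler_posdef : forall c (x : CnxCn R n), D c x ->
    posdefmx (metric_tensor (F c) x) }.

Definition depends_only_on_z (A : set (CnxCn R n)) (f : CnxCn R n -> R[i]^o) :=
  forall (z : Cn R n) (eta eta' : 'rV[R[i]]_n),
    A (z, eta) -> A (z, eta') -> f (z, eta) = f (z, eta').

Definition kahler F D : Prop :=
  forall c (x : CnxCn R n) (i k : 'I_n), D c x ->
    \sum_j torsion (F c) i j k x * x.2 0 j = 0.

Definition weakly_kahler F D : Prop :=
  forall c (x : CnxCn R n) (k : 'I_n), D c x ->
    \sum_i \sum_l \sum_j
      metric_tensor (F c) x i l * torsion (F c) i j k x * x.2 0 j
      * (x.2 0 l)^* = 0.

Definition complex_berwald F D : Prop :=
  kahler F D /\
  forall c (i j k : 'I_n), depends_only_on_z (D c) (chern_L (F c) i j k).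

Definition generalized_berwald F D : Prop :=
  forall c (i j k : 'I_n), depends_only_on_z (D c) (berwald_L (F c) i j k).

Variables (a : hermitianMetric M) (b : form10 M).

Definition randers_alpha : I -> CnxCn R n -> R[i]^o := fun c x =>
  sqrtC (\sum_i \sum_j a c x.1 i j * x.2 0 i * (x.2 0 j)^* ).

Definition randers_beta : I -> CnxCn R n -> R[i]^o := fun c x =>
  \sum_i b c x.1 0 i * x.2 0 i.

Definition randers_metric : I -> CnxCn R n -> R[i]^o := fun c x =>
  randers_alpha c x + `|randers_beta c x|.

(* |beta| is not differentiable where beta vanishes, so smoothness and all
   differential identities are restricted to this open set. *)
Definition randers_dom : I -> set (CnxCn R n) := fun c =>
  [set x | [/\ cod c x.1, x.2 != 0 & randers_beta c x != 0]].

Definition complex_randers : Prop := complex_finsler randers_metric randers_dom.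

End Finsler.

(* Main.v *)
Require Import Defs.
From mathcomp Require Import all_boot all_order all_algebra.
From mathcomp Require Import complex.
From mathcomp Require Import all_classical all_reals all_analysis.
From mathcomp Require Import ring lra.
Set Implicit Arguments.
Unset Strict Implicit.
Unset Printing Implicit Defensive.
Import Order.TTheory GRing.Theory Num.Theory.
Import numFieldNormedType.Exports.

Local Open Scope classical_set_scope.
Local Open Scope complex_scope.
Local Open Scope ring_scope.

(* Write L_i for the derivative of L in eta^i.  Euler's identities for
   L(z, l eta) = |l|^2 L(z, eta) give
     N^i_k g_{i mbar} = d_k d_{mbar} L,  N^i_k L_i = d_k L  and
     T^i_{jk} eta^j = 2 (N^i_k - G^i_k),  where G^i_k is the eta^k-derivative of G^i.
   So Kaehler means N^i_k = G^i_k, and differentiating in eta^j then identifies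
   L^i_{jk} with the Berwald coefficients.  Conversely, weakly Kaehler means
   d_k L = L_i G^i_k.  If the Berwald coefficients depend only on z, then G^i_k is
   linear in eta by Euler's identity, hence holomorphic in eta, and the
   etabar^m-derivative of d_k L = L_i G^i_k reads
   N^i_k g_{i mbar} = G^i_k g_{i mbar}; inverting g gives N^i_k = G^i_k. *)

(** * Real directional derivatives *)

(** [smooth_on] only provides continuous iterated derivatives along real lines; no total
    differential is given. The argument needs two facts that go beyond single lines. Derivatives
    must be additive in the direction, because Euler's identities read [\sum_j deta j f x * x.2 0 j]
    as one derivative along eta. Mixed derivatives must commute, because the etabar^m-derivative has
    to pass the z^k- and eta^i-derivatives of L. Both facts are obtained from the one-variable mean
    value theorem and then carried over to Wirtinger derivatives. The identities to be
    differentiated hold only where beta is nonzero. Since this set is open, an equality on it may be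
    differentiated; since it is stable under nonzero complex scaling of eta, homogeneity can be
    differentiated as well. *)

Section RealDirectional.
Context {R : realType} {V : normedModType R[i]}.
Implicit Types (g h : V -> R) (u v x y : V) (A : set V).

Lemma real_complex_continuous : continuous (fun t : R => t%:C : R[i]^o).
Proof.
move=> t; apply/cvgrPdist_lt => /= -[e e']; rewrite ltcE /= => /andP[/eqP -> e0].
near=> s; rewrite -rmorphB normc_def /= expr0n addr0 sqrtr_sqr ltcR.
by near: s; apply: cvgr_dist_lt.
Unshelve. all: by end_near. Qed.

Lemma Re_continuous : continuous (@complex.Re R : R[i]^o -> R).
Proof.
move=> z; apply/(@cvgrPdist_lt _ _ _ _ (nbhs_filter z)) => e e0.
have e0' : 0 < e%:C :> R[i] by rewrite ltcR.
have /cvgrPdist_lt/(_ _ e0') : (id : R[i]^o -> R[i]^o) @ z --> z by exact: cvg_id.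
apply: filterS => w; rewrite normc_def ltcR; apply: le_lt_trans.
case: z w => [a b] [c d] /=; rewrite -sqrtr_sqr ler_wsqrtr // lerDl; exact: sqr_ge0.
Qed.

Lemma Im_continuous : continuous (@complex.Im R : R[i]^o -> R).
Proof.
move=> z; apply/(@cvgrPdist_lt _ _ _ _ (nbhs_filter z)) => e e0.
have e0' : 0 < e%:C :> R[i] by rewrite ltcR.
have /cvgrPdist_lt/(_ _ e0') : (id : R[i]^o -> R[i]^o) @ z --> z by exact: cvg_id.
apply: filterS => w; rewrite normc_def ltcR; apply: le_lt_trans.
case: z w => [a b] [c d] /=; rewrite -sqrtr_sqr ler_wsqrtr // lerDr; exact: sqr_ge0.
Qed.

Lemma line_continuous x v : continuous (fun t : R => x + t%:C *: v).
Proof.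
move=> t; apply: cvgD; first exact: cvg_cst.
by apply: (@cvgZ _ _ _ _ _ (fun t : R => t%:C : R[i]^o) (fun=> v));
  [exact: real_complex_continuous | exact: cvg_cst].
Qed.

(** Existence and value are bundled, and everything takes place on the real line, so that the
    one-variable rules for [is_derive] apply directly. *)
Definition is_dir g v x (l : R) : Prop :=
  is_derive (0 : R) 1 (fun t : R => g (x + t%:C *: v)) l.

Definition dir v g : V -> R := fun x => derive1 (fun t : R => g (x + t%:C *: v)) 0.

Lemma is_dirE g v x l : is_dir g v x l -> dir v g x = l.
Proof. by move=> H; rewrite /dir derive1E; exact: derive_val. Qed.

Lemma derivable_is_dir g v x :
  derivable (fun t : R => g (x + t%:C *: v)) 0 1 -> is_dir g v x (dir v g x).
Proof. by move=> H; rewrite /is_dir /dir derive1E; apply/derivableP. Qed.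

Lemma near_line A x v : open A -> A x -> \forall t \near (0 : R), A (x + t%:C *: v).
Proof.
move=> oA Ax; have /= := @line_continuous x v 0; apply.
by rewrite scale0r addr0; exact: open_nbhs_nbhs.
Qed.

Lemma is_dir_local A g h v x l : open A -> A x -> {in A, g =1 h} ->
  is_dir g v x l -> is_dir h v x l.
Proof.
move=> oA Ax gh; apply: near_eq_is_derive.
by apply: filterS (near_line v oA Ax) => t At; rewrite gh // inE.
Qed.

(** The mean value theorem asks for derivatives at every parameter of a line, whereas [is_dir]
    speaks of parameter 0; sliding the base point along the line reconciles the two. *)
Lemma is_dir_line g v x (s l : R) : is_dir g v (x + s%:C *: v) l ->
  is_derive s 1 (fun t : R => g (x + t%:C *: v)) l.
Proof.
move=> H.
have -> : (fun t : R => g (x + t%:C *: v)) =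
  (fun t : R => g (x + s%:C *: v + t%:C *: v)) \o shift (- s).
  apply/funext => t /=; congr g.
  by rewrite -addrA -scalerDl -rmorphD /= [s + _]addrC subrK.
rewrite -[l]mulr1; apply: is_derive1_comp; last exact: is_derive_shift.
by rewrite /shift /= subrr.
Qed.

Lemma is_dir_scale g v x (r l : R) : is_dir g v x l ->
  is_dir g (r%:C *: v) x (r * l).
Proof.
move=> H; rewrite /is_dir.
have -> : (fun t : R => g (x + t%:C *: (r%:C *: v))) =
  (fun t : R => g (x + t%:C *: v)) \o (r \*: id).
  by apply/funext => t /=; rewrite scalerA -rmorphM /= [r *: t]mulrC.
rewrite [r * l]mulrC; apply: is_derive1_comp; first by rewrite /= scaler0.
by rewrite -[X in is_derive _ _ _ X]mulr1; exact: is_deriveZ.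
Qed.

Lemma is_dirD g h v x (a b : R) : is_dir g v x a -> is_dir h v x b ->
  is_dir (fun y => g y + h y) v x (a + b).
Proof. by move=> Hg Hh; exact: (is_deriveD Hg Hh). Qed.

Lemma is_dirN g v x (a : R) : is_dir g v x a -> is_dir (fun y => - g y) v x (- a).
Proof. by move=> Hg; exact: (is_deriveN Hg). Qed.

Lemma is_dirM g h v x (a b : R) : is_dir g v x a -> is_dir h v x b ->
  is_dir (fun y => g y * h y) v x (a * h x + g x * b).
Proof.
move=> Hg Hh; have := is_deriveM Hg Hh.
by rewrite scale0r addr0 /GRing.scale /= addrC [h x * a]mulrC.
Qed.

Lemma is_dirV g v x (a : R) : g x != 0 -> is_dir g v x a ->
  is_dir (fun y => (g y)^-1) v x (- (a * (g x)^-1 * (g x)^-1)).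
Proof.
move=> g0 Hg; have := @is_deriveV _ (fun t : R => g (x + t%:C *: v)) 0 a 1.
rewrite scale0r addr0 => /(_ g0 Hg).
by rewrite /GRing.scale /= expr2 invfM mulNr [_ / _ * a]mulrC !mulrA.
Qed.

Lemma is_dir_affine g v x (l : R) :
  (forall t : R, g (x + t%:C *: v) = g x + t * l) -> is_dir g v x l.
Proof.
move=> H; rewrite /is_dir (_ : (fun t : R => _) = (fun t => g x + t * l)).
  rewrite -[l in is_derive _ _ _ l]add0r.
  apply: is_deriveD.
  have := @is_deriveM _ _ id (cst l) (0 : R) 1 _ _
    (is_derive_id _ _) (is_derive_cst _ _ _).
  by rewrite /= scaler0 add0r /GRing.scale /= mulr1.
exact/funext.
Qed.

End RealDirectional.

(** * Mean value estimates and symmetry of second derivatives *)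

Section MeanValue.
Context {R : realType} {V : normedModType R[i]}.
Implicit Types (g h : V -> R) (u v w x y : V) (A P : set V).

(** The difference quotient equals some [df s], which lies within [e] of [c]. The condition
    symmetric in [s] covers both signs of [t]. *)
Lemma mean_value_bound (f df : R -> R) (t c e : R) :
  (forall s, `|s| <= `|t| -> is_derive s (1 : R) f (df s)) ->
  (forall s, `|s| <= `|t| -> `|df s - c| <= e) ->
  `|f t - f 0 - t * c| <= e * `|t|.
Proof.
move=> dfP dfc.
have fcont (p q : R) : (forall s, s \in `[p, q] -> `|s| <= `|t|) ->
    {within `[p, q], continuous f}.
  move=> pq; apply: derivable_within_continuous => s /pq /dfP H.
  exact: ex_derive.
have mvt (p q : R) : p <= q -> (forall s, s \in `[p, q] -> `|s| <= `|t|) ->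
    `|f q - f p - (q - p) * c| <= e * (q - p).
  move=> pq Hpq; 
  have dpq s : s \in `]p, q[ -> is_derive s (1 : R) f (df s).
    by move=> spq; apply: dfP; apply: Hpq; apply: subset_itv_oo_cc.
  have [s spq ->] := MVT_segment pq dpq (fcont _ _ Hpq).
  rewrite [_ * c]mulrC -mulrBl normrM [`|q - p|]ger0_norm ?subr_ge0 //.
  by rewrite ler_wpM2r ?subr_ge0 // dfc // Hpq.
have [t0|t0] := leP 0 t.
  have := mvt 0 t t0; rewrite !subr0 [`|t|]ger0_norm //; apply=> s.
  rewrite in_itv /= => /andP[s0 st].
  by rewrite !ger0_norm.
rewrite [X in e * X](_ : _ = 0 - t); last by rewrite sub0r ltr0_norm.
rewrite -normrN (_ : - (_ - t * c) = f 0 - f t - (0 - t) * c); last by ring.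
apply: mvt => [|s]; first exact: ltW.
rewrite in_itv /= => /andP[ts s0].
by rewrite ler0_norm // ltr0_norm // lerN2.
Qed.

Lemma nbhs_plane x u v P : nbhs x P ->
  exists2 d : R, 0 < d &
    forall s t : R, `|s| < d -> `|t| < d -> P (x + s%:C *: u + t%:C *: v).
Proof.
move=> xP.
have : (fun p : R * R => x + p.1%:C *: u + p.2%:C *: v) @ (0 : R * R) --> x.
  rewrite -[X in _ --> X]addr0 -[X in _ --> X + _]addr0.
  rewrite -{2}(scale0r v) -(scale0r u); apply: cvgD; first apply: cvgD.
  - exact: cvg_cst.
  - apply: (@cvgZ _ _ _ _ _ (fun p : R * R => p.1%:C : R[i]^o) (fun=> u));
      last exact: cvg_cst.
    apply: (@cvg_comp _ _ _ fst _ _ (nbhs (0 : R))); first exact: cvg_fst.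
    exact: (@real_complex_continuous R 0).
  - apply: (@cvgZ _ _ _ _ _ (fun p : R * R => p.2%:C : R[i]^o) (fun=> v));
      last exact: cvg_cst.
    apply: (@cvg_comp _ _ _ snd _ _ (nbhs (0 : R))); first exact: cvg_snd.
    exact: (@real_complex_continuous R 0).
move=> /(_ _ xP) [[B C]] /= [/nbhs_ballP[d1 /= d1_gt0 B1]].
move=> /nbhs_ballP[d2 /= d2_gt0 C2] BC.
exists (Num.min d1 d2); first by rewrite lt_min d1_gt0.
move=> s t; rewrite !lt_min => /andP[s1 _] /andP[_ t2].
apply: (BC (s, t)); split; [apply: B1 | apply: C2];
  by rewrite /ball /= sub0r normrN.
Qed.

Lemma is_dir_bound g v x (l e : R) : is_dir g v x l -> 0 < e ->
  exists2 d : R, 0 < d &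
    forall t : R, `|t| < d -> `|g (x + t%:C *: v) - g x - t * l| <= e * `|t|.
Proof.
move=> [dg <-] e0.
have /cvgrPdist_lt/(_ _ e0) := dg.
rewrite near_withinE => /nbhs_ballP[d /= d0 H]; exists d => // t td.
have [->|tn0] := eqVneq t 0.
  by rewrite scale0r addr0 mul0r subr0 subrr normr0 mulr0.
have := H t; rewrite /ball /= sub0r normrN => /(_ td tn0) /ltW.
rewrite -/('D_(1 : R) (fun s : R => g (x + s%:C *: v)) 0).
rewrite addr0 scale0r addr0 [_%:A]mulr1 distrC => H'.
rewrite (_ : _ - _ = t * (t^-1 *: (g (x + t%:C *: v) - g x) -
   'D_1 (fun t : R => g (x + t%:C *: v)) 0)); last first.
  by rewrite mulrBr /GRing.scale /= mulrA divff // mul1r.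
by rewrite normrM mulrC ler_wpM2r.
Qed.

(** In [is_dir_bound] the radius depends on the base point. Continuity of [dir v g] at [x] makes one
    radius and one slope serve all base points displaced along [u], through the mean value estimate
    on each parallel line. *)
Lemma strict_dir_bound A g v x (e : R) u : open A -> A x ->
  (forall y, A y -> is_dir g v y (dir v g y)) ->
  {for x, continuous (dir v g)} -> 0 < e ->
  exists2 d : R, 0 < d & forall s t : R, `|s| < d -> `|t| < d ->
    A (x + s%:C *: u) /\
    `|g (x + s%:C *: u + t%:C *: v) - g (x + s%:C *: u) - t * dir v g x| <= e * `|t|.
Proof.
move=> oA Ax gA gc e0.
have gnear : \forall y \near x, `|dir v g y - dir v g x| < e.
  by move/cvgrPdist_lt/(_ _ e0): gc; apply: filterS => y; rewrite distrC.
have Anear : \forall y \near x, A y by apply: open_nbhs_nbhs.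
have [d d0 H] := nbhs_plane u v (filterI Anear gnear).
exists d => // s t sd td; split.
  by have [] := H s 0 sd; rewrite ?normr0 // scale0r addr0.
have := @mean_value_bound (fun r : R => g (x + s%:C *: u + r%:C *: v))
   (fun r : R => dir v g (x + s%:C *: u + r%:C *: v)) t (dir v g x) e.
rewrite scale0r addr0; apply=> r rt; have [Ar gr] := H s r sd (le_lt_trans rt td).
  by apply: is_dir_line; exact: gA.
exact: ltW.
Qed.

Lemma eq0_small_multiple (c k : R) : 0 < k ->
  (forall e, 0 < e -> `|c| <= k * e) -> c = 0.
Proof.
move=> k0 H; apply/normr0_eq0/le_anti/andP; split => //.
apply/ler_addgt0Pr => e e0; rewrite add0r.
by have := H (e / k) (divr_gt0 e0 k0); rewrite mulrC divfK ?gt_eqF.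
Qed.

(** Go from [x] to [x + t u], then to [x + t u + t w]. The second leg starts at a moving point, so
    its expansion has to be the uniform one; this is where continuity of the [w]-derivative
    enters. *)
Lemma dir_add A g u w x : open A -> A x ->
  (forall v y, A y -> is_dir g v y (dir v g y)) ->
  {for x, continuous (dir w g)} ->
  dir (u + w) g x = dir u g x + dir w g x.
Proof.
(* The 3 counts the errors: the two legs and the diagonal, each at most [e * t]. *)
move=> oA Ax gA gc; apply/subr0_eq; apply: (@eq0_small_multiple _ 3) => // e e0.
have [d1 d10 H1] := is_dir_bound (gA (u + w) x Ax) e0.
have [d2 d20 H2] := is_dir_bound (gA u x Ax) e0.
have [d3 d30 H3] := strict_dir_bound u oA Ax (gA w) gc e0.
pose d := Num.min d1 (Num.min d2 d3); pose t := d / 2.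
have d0 : 0 < d by rewrite !lt_min d10 d20.
have t0 : 0 < t by rewrite divr_gt0.
have : `|t| < d by rewrite gtr0_norm // /t; lra.
rewrite !lt_min => /and3P[td1 td2 td3].
have [_] := H3 t t td3 td3; have := H1 t td1; have := H2 t td2.
rewrite (gtr0_norm t0) scalerDr addrA => h2 h1 h3.
rewrite -(ler_pM2l t0) -[X in X * `|_|](gtr0_norm t0) -normrM.
have E (a b c p q r : R) :
    `|b - c - t * p| <= e * t -> `|a - c - t * r| <= e * t ->
    `|a - b - t * q| <= e * t -> `|t * (r - (p + q))| <= t * (3 * e).
  move=> hp hr hq; rewrite (_ : t * (r - (p + q)) =
    (b - c - t * p) + (a - b - t * q) - (a - c - t * r)); last by ring.
  rewrite (_ : t * (3 * e) = e * t + e * t + e * t); last by ring.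
  by rewrite (le_trans (ler_normB _ _)) // lerD // (le_trans (ler_normD _ _)) // lerD.
exact: E h2 h1 h3.
Qed.

(** The second difference over the parallelogram is the increment in [s] of g(x + t v + s u) - g(x +
    s u). Its [s]-derivative is an increment of [dir u g] along [v], hence close to [t] times the
    mixed derivative by [strict_dir_bound]; the mean value estimate then supplies the second factor
    [t]. *)
Lemma second_difference_bound A g u v x (e : R) : open A -> A x ->
  (forall y, A y -> is_dir g u y (dir u g y)) ->
  (forall y, A y -> is_dir (dir u g) v y (dir v (dir u g) y)) ->
  {for x, continuous (dir v (dir u g))} -> 0 < e ->
  exists2 d : R, 0 < d & forall t : R, `|t| < d ->
    `|g (x + t%:C *: u + t%:C *: v) - g (x + t%:C *: u) - g (x + t%:C *: v) + g x
      - t * t * dir v (dir u g) x| <= e * `|t| * `|t|.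
Proof.
move=> oA Ax gA gA2 gc e0.
have [d1 d10 H1] := strict_dir_bound u oA Ax gA2 gc e0.
have [d2 d20 H2] := nbhs_plane u v (open_nbhs_nbhs (conj oA Ax)).
exists (Num.min d1 d2); first by rewrite lt_min d10.
move=> t; rewrite lt_min => /andP[td1 td2].
pose f (s : R) := g (x + t%:C *: v + s%:C *: u) - g (x + s%:C *: u).
have := @mean_value_bound f
  (fun s => dir u g (x + t%:C *: v + s%:C *: u) - dir u g (x + s%:C *: u))
  t (t * dir v (dir u g) x) (e * `|t|).
rewrite [f t]/f [f 0]/f scale0r !addr0 => H.
rewrite [x + _ + _]addrAC (_ : _ - _ = g (x + t%:C *: v + t%:C *: u) - g (x + t%:C *: u)
    - (g (x + t%:C *: v) - g x) - t * (t * dir v (dir u g) x)); last by ring.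
apply: H => s st.
  apply: is_deriveB; apply: is_dir_line; apply: gA.
    by rewrite addrAC; apply: H2 => //; exact: le_lt_trans td2.
  by have [] := H1 s t (le_lt_trans st td1) td1.
rewrite [x + _ + _]addrAC.
by have [] := H1 s t (le_lt_trans st td1) td1.
Qed.

(** The second difference is symmetric in [u] and [v], so after division by [t * t] it approximates
    both mixed derivatives; the two errors account for the constant 2. *)
Lemma dir_comm A g u v x : open A -> A x ->
  (forall w y, A y -> is_dir g w y (dir w g y)) ->
  (forall w w' y, A y -> is_dir (dir w g) w' y (dir w' (dir w g) y)) ->
  (forall w w', {for x, continuous (dir w' (dir w g))}) ->
  dir v (dir u g) x = dir u (dir v g) x.
Proof.
move=> oA Ax gA gA2 gc; apply/subr0_eq.
apply: (@eq0_small_multiple _ 2) => // e e0.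
have [d1 d10 H1] := second_difference_bound oA Ax (gA u) (gA2 u v) (gc u v) e0.
have [d2 d20 H2] := second_difference_bound oA Ax (gA v) (gA2 v u) (gc v u) e0.
pose d := Num.min d1 d2; pose t := d / 2.
have d0 : 0 < d by rewrite lt_min d10 d20.
have t0 : 0 < t by rewrite divr_gt0.
have : `|t| < d by rewrite gtr0_norm // /t; lra.
rewrite lt_min => /andP[td1 td2].
have := H1 t td1; have := H2 t td2.
rewrite [x + _ + t%:C *: u]addrAC (gtr0_norm t0).
move=> h2 h1; have tt0 : 0 < t * t by rewrite mulr_gt0.
rewrite -(ler_pM2l tt0) -[X in X * `|_|](gtr0_norm tt0) -normrM.
have E (a b c r p q : R) :
    `|a - b - c + r - t * t * q| <= e * t * t ->
    `|a - c - b + r - t * t * p| <= e * t * t -> `|t * t * (p - q)| <= t * t * (2 * e).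
  move=> hq hp; rewrite (_ : t * t * (p - q) = (a - b - c + r - t * t * q) -
    (a - c - b + r - t * t * p)); last by ring.
  rewrite (_ : t * t * (2 * e) = e * t * t + e * t * t); last by ring.
  by rewrite (le_trans (ler_normB _ _)) // lerD.
exact: E h2 h1.
Qed.

End MeanValue.

(** * Smooth functions *)

Section SmoothFunctions.
Context {R : realType} {V : normedModType R[i]}.
Variable A : set V.
Hypothesis oA : open A.
Implicit Types (g h : V -> R) (u v w x y : V).

(** Recursion on the order, in place of lists of directions, provides the induction for products and
    inverses: differentiating once leaves products of functions that are regular to one order
    less. *)
Fixpoint diffn (k : nat) g : Prop :=
  (forall x, A x -> {for x, continuous g}) /\
  if k is k'.+1 then
    forall v, (forall x, A x -> is_dir g v x (dir v g x)) /\ diffn k' (dir v g)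
  else True.

Definition smooth g : Prop := forall k, diffn k g.

Lemma diffn_continuous k g x : diffn k g -> A x -> {for x, continuous g}.
Proof. by case: k => [|k] [cg _]; exact: cg. Qed.

Lemma diffnW k g : diffn k.+1 g -> diffn k g.
Proof.
elim: k g => [|k IH] g [cg dg]; split => // v; have [dgv sg] := dg v.
by split => //; exact: IH.
Qed.

Lemma dir_local g h v x : {in A, g =1 h} -> A x ->
  is_dir g v x (dir v g x) -> dir v h x = dir v g x.
Proof. by move=> gh Ax /(is_dir_local oA Ax gh) /is_dirE. Qed.

Lemma continuous_local g h x : {in A, g =1 h} -> A x ->
  {for x, continuous g} -> {for x, continuous h}.
Proof.
move=> gh Ax; rewrite /prop_for /continuous_at -(gh x) ?inE//.
apply: cvg_trans; apply: near_eq_cvg.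
by apply: filterS (open_nbhs_nbhs (conj oA Ax)) => y Ay; rewrite gh // inE.
Qed.

Lemma diffn_local k g h : {in A, g =1 h} -> diffn k g -> diffn k h.
Proof.
elim: k g h => [|k IH] g h gh [cg dg];
  (split; first by move=> x Ax; exact: continuous_local (cg x Ax)) => // v.
have [dgv sg] := dg v.
have E : {in A, dir v g =1 dir v h}.
  move=> x; rewrite inE => Ax.
  by rewrite (dir_local gh Ax) //; exact: dgv.
split; last exact: IH E sg.
move=> x Ax; rewrite -E ?inE//; apply: (is_dir_local oA Ax gh); exact: dgv.
Qed.

Lemma diffn_cst k (c : R) : diffn k (fun=> c).
Proof.
elim: k c => [|k IH] c; (split; first by move=> x Ax; exact: cvg_cst) => // v.
have E x : is_dir (fun=> c) v x 0 by apply: is_dir_affine => t; rewrite mulr0 addr0.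
split=> [x Ax|]; first by rewrite (is_dirE (E x)).
apply: (@diffn_local _ (fun=> 0)); last exact: IH.
by move=> x _; rewrite (is_dirE (E x)).
Qed.

Lemma diffnD k g h : diffn k g -> diffn k h -> diffn k (fun x => g x + h x).
Proof.
elim: k g h => [|k IH] g h [cg dg] [ch dh];
  (split; first by move=> x Ax; apply: cvgD; [exact: cg | exact: ch]) => // v.
have [dgv sg] := dg v; have [dhv sh] := dh v.
have E x : A x -> is_dir (fun y => g y + h y) v x (dir v g x + dir v h x).
  by move=> Ax; apply: is_dirD; [exact: dgv | exact: dhv].
split=> [x Ax|]; first by rewrite (is_dirE (E x Ax)); exact: E.
apply: (@diffn_local _ (fun x => dir v g x + dir v h x)); last exact: IH.
by move=> x; rewrite inE => Ax; rewrite (is_dirE (E x Ax)).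
Qed.

Lemma diffnM k g h : diffn k g -> diffn k h -> diffn k (fun x => g x * h x).
Proof.
elim: k g h => [|k IH] g h Cg Ch;
  (split; first by move=> x Ax; apply: cvgM; [exact: Cg.1 | exact: Ch.1]) => // v.
have [dgv sg] := Cg.2 v; have [dhv sh] := Ch.2 v.
have E x : A x ->
    is_dir (fun y => g y * h y) v x (dir v g x * h x + g x * dir v h x).
  by move=> Ax; apply: is_dirM; [exact: dgv | exact: dhv].
split=> [x Ax|]; first by rewrite (is_dirE (E x Ax)); exact: E.
apply: (@diffn_local _ (fun x => dir v g x * h x + g x * dir v h x)).
  by move=> x; rewrite inE => Ax; rewrite (is_dirE (E x Ax)).
by apply: diffnD; apply: IH => //; exact: diffnW.
Qed.

Lemma diffnN k g : diffn k g -> diffn k (fun x => - g x).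
Proof.
move=> Cg; apply: (@diffn_local _ (fun x => -1 * g x)).
  by move=> x _; rewrite mulN1r.
by apply: diffnM => //; exact: diffn_cst.
Qed.

Lemma diffnV k g : (forall x, A x -> g x != 0) -> diffn k g ->
  diffn k (fun x => (g x)^-1).
Proof.
move=> g0; elim: k => [|k IH] Cg;
  (split; first by move=> x Ax; apply: cvgV; [exact: g0 | exact: Cg.1]) => // v.
have [dgv sg] := Cg.2 v; have Vg := IH (diffnW Cg).
have E x : A x ->
    is_dir (fun y => (g y)^-1) v x (- (dir v g x * (g x)^-1 * (g x)^-1)).
  by move=> Ax; apply: is_dirV; [exact: g0 | exact: dgv].
split=> [x Ax|]; first by rewrite (is_dirE (E x Ax)); exact: E.
apply: (@diffn_local _ (fun x => - (dir v g x * (g x)^-1 * (g x)^-1))).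
  by move=> x; rewrite inE => Ax; rewrite (is_dirE (E x Ax)).
by apply: diffnN; do 2!apply: diffnM => //.
Qed.

Lemma diffn_affine k g (l : V -> R) : continuous g ->
  (forall x v (t : R), g (x + t%:C *: v) = g x + t * l v) -> diffn k g.
Proof.
move=> cg gl; case: k => [|k]; (split; first by move=> x _; exact: cg) => // v.
have E x : is_dir g v x (l v) by exact: is_dir_affine.
split=> [x Ax|]; first by rewrite (is_dirE (E x)).
apply: (@diffn_local _ (fun=> l v)); last exact: diffn_cst.
by move=> x _; rewrite (is_dirE (E x)).
Qed.

Lemma smooth_dir g v : smooth g -> smooth (dir v g).
Proof. by move=> sg k; have [_ /(_ v)[]] := sg k.+1. Qed.

Lemma smooth_is_dir g v x : smooth g -> A x -> is_dir g v x (dir v g x).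
Proof. by move=> sg; have [_ /(_ v)[H _]] := sg 1; exact: H. Qed.

Lemma smooth_continuous g x : smooth g -> A x -> {for x, continuous g}.
Proof. by move=> sg; exact: diffn_continuous (sg 0). Qed.

Lemma smooth_dir_add g u w x : smooth g -> A x ->
  dir (u + w) g x = dir u g x + dir w g x.
Proof.
move=> sg Ax; apply: dir_add (oA) (Ax) _ _ => [v y Ay|].
  exact: smooth_is_dir.
exact: smooth_continuous (smooth_dir _ sg) Ax.
Qed.

Lemma smooth_dir_scale g v x (r : R) : smooth g -> A x ->
  dir (r%:C *: v) g x = r * dir v g x.
Proof. by move=> sg Ax; apply/is_dirE/is_dir_scale/smooth_is_dir. Qed.

Lemma smooth_dir_comm g u v x : smooth g -> A x ->
  dir v (dir u g) x = dir u (dir v g) x.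
Proof.
move=> sg Ax; apply: dir_comm (oA) (Ax) _ _ _ => [w y|w w' y|w w'].
- exact: smooth_is_dir.
- by apply: smooth_is_dir; exact: smooth_dir.
- by apply: smooth_continuous (Ax); do 2!apply: smooth_dir.
Qed.

End SmoothFunctions.

(** * Complex-valued smooth functions, through their real and imaginary parts *)

Section ComplexSmooth.
Context {R : realType} {V : normedModType R[i]}.
Variable A : set V.
Hypothesis oA : open A.
Local Notation C := (R[i]).
Implicit Types (f g : V -> C^o) (u v w x y : V) (s c : C).

Definition csmooth f : Prop :=
  smooth A (fun x => complex.Re (f x)) /\ smooth A (fun x => complex.Im (f x)).

Lemma smooth_on_csmooth f : smooth_on A f -> csmooth f.
Proof.
move=> sf; suff H k : forall f, smooth_on A f ->
    diffn A k (fun x => complex.Re (f x)) /\ diffn A k (fun x => complex.Im (f x)).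
  by split=> k; have [] := H k f sf.
elim: k => [|k IH] {sf}f sf.
  split; split=> // x Ax; have [cf _] := sf [::] x Ax.
    by apply: (continuous_comp cf); exact: Re_continuous.
  by apply: (continuous_comp cf); exact: Im_continuous.
(* [foldr] applies the last direction of the list first, so differentiating [f] along [v] beforehand
   means appending [v] at the end. *)
have sdf v : smooth_on A (rderive v f).
  by move=> vs x Ax; have := sf (rcons vs v) x Ax; rewrite foldr_rcons.
split; split.
- by move=> x Ax; apply: continuous_comp (sf [::] x Ax).1 _; exact: Re_continuous.
- move=> v; split=> [x Ax|]; last by have [] := IH _ (sdf v).
  exact: derivable_is_dir ((sf [::] x Ax).2 v).1.
- by move=> x Ax; apply: continuous_comp (sf [::] x Ax).1 _; exact: Im_continuous.
- move=> v; split=> [x Ax|]; last by have [] := IH _ (sdf v).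
  exact: derivable_is_dir ((sf [::] x Ax).2 v).2.
Qed.

Lemma csmooth_local f g : {in A, f =1 g} -> csmooth f -> csmooth g.
Proof.
by move=> fg [sr si]; split=> k; [have := sr k | have := si k];
  apply: diffn_local => // x Ax; rewrite fg.
Qed.

Lemma csmooth_cst c : csmooth (fun=> c).
Proof. by split=> k; exact: diffn_cst. Qed.

Lemma csmoothD f g : csmooth f -> csmooth g -> csmooth (fun x => f x + g x).
Proof.
move=> [fr fi] [gr gi]; split=> k.
  have := diffnD oA (fr k) (gr k).
  by apply: diffn_local => // x _; case: (f x) (g x) => [a b] [].
have := diffnD oA (fi k) (gi k).
by apply: diffn_local => // x _; case: (f x) (g x) => [a b] [].
Qed.

Lemma csmoothM f g : csmooth f -> csmooth g -> csmooth (fun x => f x * g x).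
Proof.
move=> [fr fi] [gr gi]; split=> k.
  have := diffnD oA (diffnM oA (fr k) (gr k)) (diffnN oA (diffnM oA (fi k) (gi k))).
  by apply: diffn_local => // x _; case: (f x) (g x) => [a b] [].
have := diffnD oA (diffnM oA (fr k) (gi k)) (diffnM oA (fi k) (gr k)).
by apply: diffn_local => // x _; case: (f x) (g x) => [a b] [].
Qed.

Lemma csmoothV f : (forall x, A x -> f x != 0) -> csmooth f ->
  csmooth (fun x => (f x)^-1).
Proof.
move=> f0 [fr fi].
(* [n] is the squared modulus: the inverse of [f] is its conjugate divided by [n], which leaves only
   a real inverse to treat. *)
pose n x := complex.Re (f x) * complex.Re (f x) + complex.Im (f x) * complex.Im (f x).
have n0 x : A x -> n x != 0.
  move=> Ax; apply: contraNneq (f0 x Ax) => /eqP.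
  rewrite /n -!expr2 paddr_eq0 ?sqr_ge0// !sqrf_eq0 eq_complex /=.
  by [].
have nk k : diffn A k (fun x => (n x)^-1).
  by apply: diffnV => //; apply: diffnD => //; exact: diffnM.
split=> k.
  have := diffnM oA (fr k) (nk k).
  by apply: diffn_local => // x _; rewrite /n; case: (f x) => a b; rewrite -!expr2.
have := diffnN oA (diffnM oA (fi k) (nk k)).
by apply: diffn_local => // x _; rewrite /n; case: (f x) => a b; rewrite -!expr2.
Qed.

Lemma csmooth_sum (I : Type) (r : seq I) (P : pred I) (F : I -> V -> C^o) :
  (forall i, csmooth (F i)) -> csmooth (fun x => \sum_(i <- r | P i) F i x).
Proof.
move=> sF; elim: r => [|i r IH].
  by apply: csmooth_local (csmooth_cst 0) => x _; rewrite big_nil.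
case Pi : (P i).
  by apply: csmooth_local (csmoothD (sF i) IH) => x _; rewrite big_cons Pi.
by apply: csmooth_local IH => x _; rewrite big_cons Pi.
Qed.

Lemma csmooth_prod (I : Type) (r : seq I) (P : pred I) (F : I -> V -> C^o) :
  (forall i, csmooth (F i)) -> csmooth (fun x => \prod_(i <- r | P i) F i x).
Proof.
move=> sF; elim: r => [|i r IH].
  by apply: csmooth_local (csmooth_cst 1) => x _; rewrite big_nil.
case Pi : (P i).
  by apply: csmooth_local (csmoothM (sF i) IH) => x _; rewrite big_cons Pi.
by apply: csmooth_local IH => x _; rewrite big_cons Pi.
Qed.

Lemma csmooth_det n (M : V -> 'M[C]_n) :
  (forall i j, csmooth (fun x => M x i j)) -> csmooth (fun x => \det (M x)).
Proof.
move=> sM; apply: csmooth_sum => s; apply: csmoothM; first exact: csmooth_cst.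
exact: csmooth_prod.
Qed.

Lemma csmooth_invmx n (M : V -> 'M[C]_n) :
  (forall i j, csmooth (fun x => M x i j)) ->
  (forall x, A x -> M x \in unitmx) ->
  forall i j, csmooth (fun x => invmx (M x) i j).
Proof.
move=> sM uM i j.
(* Cramer's rule. The equality is claimed on [A] only, since [invmx] returns its argument on a
   singular matrix. *)
apply: (@csmooth_local (fun x => (\det (M x))^-1 * cofactor (M x) j i)).
  by move=> x; rewrite inE => Ax; rewrite /invmx uM // !mxE.
apply: csmoothM.
  apply: csmoothV; last exact: csmooth_det.
  by move=> x Ax; have := uM x Ax; rewrite unitmxE unitfE.
apply: csmoothM; first exact: csmooth_cst.
apply: csmooth_det => k l.
by apply: csmooth_local (sM (lift j k) (lift i l)) => x _; rewrite !mxE.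
Qed.

Lemma csmooth_rderive v f : csmooth f -> csmooth (rderive v f).
Proof. by move=> [fr fi]; split; [exact: smooth_dir v fr | exact: smooth_dir v fi]. Qed.

Lemma rderive_local v f g x : {in A, f =1 g} -> csmooth f -> A x ->
  rderive v g x = rderive v f x.
Proof.
move=> fg [fr fi] Ax.
have fgr : {in A, (fun y => complex.Re (f y)) =1 (fun y => complex.Re (g y))}.
  by move=> y Ay; rewrite fg.
have fgi : {in A, (fun y => complex.Im (f y)) =1 (fun y => complex.Im (g y))}.
  by move=> y Ay; rewrite fg.
rewrite /rderive; congr (_ +i* _).
  exact: (dir_local oA fgr Ax (smooth_is_dir v fr Ax)).
exact: (dir_local oA fgi Ax (smooth_is_dir v fi Ax)).
Qed.

Lemma rderiveE v f x (l : C) :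
  is_dir (fun x => complex.Re (f x)) v x (complex.Re l) ->
  is_dir (fun x => complex.Im (f x)) v x (complex.Im l) -> rderive v f x = l.
Proof.
case: l => a b Hr Hi; rewrite /rderive.
by rewrite [X in X +i* _](is_dirE Hr) [X in _ +i* X](is_dirE Hi).
Qed.

Lemma is_dir_Re v f x : csmooth f -> A x ->
  is_dir (fun x => complex.Re (f x)) v x (complex.Re (rderive v f x)).
Proof. by move=> [fr _] Ax; exact: smooth_is_dir fr Ax. Qed.

Lemma is_dir_Im v f x : csmooth f -> A x ->
  is_dir (fun x => complex.Im (f x)) v x (complex.Im (rderive v f x)).
Proof. by move=> [_ fi] Ax; exact: smooth_is_dir fi Ax. Qed.

Lemma rderive_cst v c x : rderive v (fun=> c : C^o) x = 0.
Proof.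
by apply: rderiveE => /=; apply: is_dir_affine => t; rewrite mulr0 addr0.
Qed.

Lemma ReD c s : complex.Re (c + s) = complex.Re c + complex.Re s.
Proof. by case: c s => [a b] []. Qed.

Lemma ImD c s : complex.Im (c + s) = complex.Im c + complex.Im s.
Proof. by case: c s => [a b] []. Qed.

Lemma ReM c s : complex.Re (c * s) =
  complex.Re c * complex.Re s - complex.Im c * complex.Im s.
Proof. by case: c s => [a b] []. Qed.

Lemma ImM c s : complex.Im (c * s) =
  complex.Re c * complex.Im s + complex.Im c * complex.Re s.
Proof. by case: c s => [a b] []. Qed.

Lemma rderiveD v f g x : csmooth f -> csmooth g -> A x ->
  rderive v (fun y => f y + g y) x = rderive v f x + rderive v g x.
Proof.
move=> sf sg Ax; apply: rderiveE.
  have := is_dirD (is_dir_Re v sf Ax) (is_dir_Re v sg Ax).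
  by rewrite -ReD /is_dir; under eq_fun do rewrite -ReD.
have := is_dirD (is_dir_Im v sf Ax) (is_dir_Im v sg Ax).
by rewrite -ImD /is_dir; under eq_fun do rewrite -ImD.
Qed.

Lemma rderiveM v f g x : csmooth f -> csmooth g -> A x ->
  rderive v (fun y => f y * g y) x = rderive v f x * g x + f x * rderive v g x.
Proof.
move=> sf sg Ax.
have fr := is_dir_Re v sf Ax; have fi := is_dir_Im v sf Ax.
have gr := is_dir_Re v sg Ax; have gi := is_dir_Im v sg Ax.
apply: rderiveE.
  have := is_dirD (is_dirM fr gr) (is_dirN (is_dirM fi gi)).
  rewrite opprD addrACA -!ReM -ReD /is_dir.
  by under eq_fun do rewrite -ReM.
have := is_dirD (is_dirM fr gi) (is_dirM fi gr).
rewrite addrACA -!ImM -ImD /is_dir.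
by under eq_fun do rewrite -ImM.
Qed.

Lemma rderive_comm u v f x : csmooth f -> A x ->
  rderive u (rderive v f) x = rderive v (rderive u f) x.
Proof.
move=> [fr fi] Ax.
have E w w' : rderive w (rderive w' f) x =
    dir w (dir w' (fun y => complex.Re (f y))) x +i*
    dir w (dir w' (fun y => complex.Im (f y))) x by [].
by rewrite !E (smooth_dir_comm oA v u fr Ax) (smooth_dir_comm oA v u fi Ax).
Qed.

Lemma rderive_addv u v f x : csmooth f -> A x ->
  rderive (u + v) f x = rderive u f x + rderive v f x.
Proof.
move=> [fr fi] Ax; rewrite /rderive; congr (_ +i* _).
  exact: (smooth_dir_add oA u v fr Ax).
exact: (smooth_dir_add oA u v fi Ax).
Qed.

Lemma rderive_scalev v f x (r : R) : csmooth f -> A x ->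
  rderive (r%:C *: v) f x = r%:C * rderive v f x.
Proof.
move=> [fr fi] Ax; rewrite /rderive.
rewrite [X in X +i* _](smooth_dir_scale _ _ fr Ax).
rewrite [X in _ +i* X](smooth_dir_scale _ _ fi Ax).
by apply/eqP; rewrite eq_complex /= !mul0r subr0 addr0 !eqxx.
Qed.

End ComplexSmooth.

(** * Wirtinger derivatives *)

Section Wirtinger.
Context {R : realType} {V : normedModType R[i]}.
Variable A : set V.
Hypothesis oA : open A.
Local Notation C := (R[i]).
Implicit Types (f g : V -> C^o) (u v w x y : V) (s c : C).

(* The holomorphic derivative is the case [s = - 'i], the antiholomorphic one
   the case [s = 'i]. *)
Definition wder s v f : V -> C^o :=
  fun x => (rderive v f x + s * rderive ('i%C *: v) f x) / 2.

Lemma wirtingerE v f : wirtinger v f = wder (- 'i%C) v f.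
Proof. by apply/funext => x; rewrite /wirtinger /wder mulNr. Qed.

Lemma csmooth_wder s v f : csmooth A f -> csmooth A (wder s v f).
Proof.
move=> sf; apply: csmoothM => //; last exact: csmooth_cst.
apply: csmoothD => //; first exact: csmooth_rderive.
by apply: csmoothM => //; [exact: csmooth_cst | exact: csmooth_rderive].
Qed.

Lemma wder_local s v f g x : {in A, f =1 g} -> csmooth A f -> A x ->
  wder s v g x = wder s v f x.
Proof. by move=> fg sf Ax; rewrite /wder !(rderive_local oA _ fg sf Ax). Qed.

Lemma wder_cst s v c x : wder s v (fun=> c) x = 0.
Proof. by rewrite /wder !rderive_cst mulr0 addr0 mul0r. Qed.

Lemma wderD s v f g x : csmooth A f -> csmooth A g -> A x ->
  wder s v (fun y => f y + g y) x = wder s v f x + wder s v g x.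
Proof.
move=> sf sg Ax; rewrite /wder !(rderiveD _ sf sg Ax) -mulrDl.
by rewrite mulrDr addrACA.
Qed.

Lemma wderM s v f g x : csmooth A f -> csmooth A g -> A x ->
  wder s v (fun y => f y * g y) x = wder s v f x * g x + f x * wder s v g x.
Proof. by move=> sf sg Ax; rewrite /wder !(rderiveM _ sf sg Ax); ring. Qed.

Lemma wder_sum s v (I : Type) (r : seq I) (P : pred I) (F : I -> V -> C^o) x :
  (forall i, csmooth A (F i)) -> A x ->
  wder s v (fun y => \sum_(i <- r | P i) F i y) x =
  \sum_(i <- r | P i) wder s v (F i) x.
Proof.
move=> sF Ax; elim: r => [|i r IH].
  rewrite big_nil (_ : (fun y => _) = fun=> 0) ?wder_cst//.
  by apply/funext => y; rewrite big_nil.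
rewrite big_cons -IH; case Pi : (P i).
  rewrite -wderD//; last exact: csmooth_sum.
  by congr (wder s v _ x); apply/funext => y; rewrite big_cons Pi.
by congr (wder s v _ x); apply/funext => y; rewrite big_cons Pi.
Qed.

Lemma rderive_wder u s v f x : csmooth A f -> A x ->
  rderive u (wder s v f) x =
  (rderive u (rderive v f) x + s * rderive u (rderive ('i%C *: v) f) x) / 2.
Proof.
move=> sf Ax; have sr w := csmooth_rderive w sf; have sc c := csmooth_cst oA c.
rewrite /wder (rderiveM (A := A))//; last first.
  by apply: csmoothD => //; exact: csmoothM.
rewrite rderive_cst mulr0 addr0 (rderiveD (A := A))//; last exact: csmoothM.
by rewrite (rderiveM (A := A))// rderive_cst mul0r add0r.
Qed.

(** Leaving [s] and [s'] free treats holomorphic and antiholomorphic derivatives at once; expansion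
    reduces the claim to four exchanges of real derivatives. *)
Lemma wder_comm s s' u v f x : csmooth A f -> A x ->
  wder s u (wder s' v f) x = wder s' v (wder s u f) x.
Proof.
move=> sf Ax; rewrite {1 3}/wder !(rderive_wder _ _ _ sf Ax).
have E w w' := rderive_comm oA w w' sf Ax.
rewrite (E v u) (E ('i%C *: v) u) (E v ('i%C *: u)) (E ('i%C *: v) ('i%C *: u)).
set a := rderive u _ x; set b := rderive u _ x.
set c := rderive _ _ x; set d := rderive _ _ x.
by ring.
Qed.

Lemma wder_addv s u v f x : csmooth A f -> A x ->
  wder s (u + v) f x = wder s u f x + wder s v f x.
Proof.
by move=> sf Ax; rewrite /wder scalerDr !(rderive_addv oA _ _ sf Ax); ring.
Qed.

(** The factor is [c] for [s = - 'i] and its conjugate for [s = 'i]. In general the two sides differ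
    by a multiple of [1 + s * s]. *)
Lemma wder_scalev s c v f x : s * s = -1 -> csmooth A f -> A x ->
  wder s (c *: v) f x =
  ((complex.Re c)%:C - s * (complex.Im c)%:C) * wder s v f x.
Proof.
move=> s2 sf Ax; rewrite /wder.
set a := complex.Re c; set b := complex.Im c.
have cE : c = a%:C + b%:C * 'i%C by rewrite [LHS]complexE mulrC.
have -> : c *: v = a%:C *: v + b%:C *: ('i%C *: v) by rewrite scalerA -scalerDl -cE.
have -> : 'i%C *: (a%:C *: v + b%:C *: ('i%C *: v)) =
    a%:C *: ('i%C *: v) + (- b)%:C *: v.
  rewrite scalerDr !scalerA -!mulrA [_ * a%:C]mulrC; congr (_ + _ *: _).
  by rewrite mulrCA -expr2 sqr_i mulrN1 rmorphN.
rewrite !(rderive_addv oA _ _ sf Ax) !(rderive_scalev _ _ sf Ax) rmorphN /=.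
set p := rderive v f x; set q := rderive _ f x.
apply/subr0_eq; rewrite (_ : _ - _ = (1 + s * s) * (b%:C * q) / 2); last by ring.
by rewrite s2 subrr !mul0r.
Qed.

Lemma wder_scaleN c v f x : csmooth A f -> A x ->
  wder (- 'i%C) (c *: v) f x = c * wder (- 'i%C) v f x.
Proof.
move=> sf Ax; rewrite wder_scalev // ?mulrNN -?expr2 ?sqr_i //.
by rewrite mulNr opprK -complexE.
Qed.

Lemma wder_scalei c v f x : csmooth A f -> A x ->
  wder 'i%C (c *: v) f x = c^*%C * wder 'i%C v f x.
Proof.
move=> sf Ax; rewrite wder_scalev // -?expr2 ?sqr_i //.
by congr (_ * _); case: c => a b; apply/eqP; rewrite eq_complex /=; apply/andP;
  split; apply/eqP; ring.
Qed.

Lemma wder_sumv s (I : Type) (r : seq I) (P : pred I) (vs : I -> V) f x :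
  csmooth A f -> A x ->
  wder s (\sum_(i <- r | P i) vs i) f x = \sum_(i <- r | P i) wder s (vs i) f x.
Proof.
move=> sf Ax; apply: (big_morph (fun v => wder s v f x)) => [u v|].
  exact: wder_addv.
by apply: (@addrI _ (wder s 0 f x)); rewrite -wder_addv // !addr0.
Qed.

End Wirtinger.

(** * Homogeneity in the fibers and Euler's identities *)

Section FiberCalculus.
Context {R : realType} {n : nat}.
Local Notation C := (R[i]).
Local Notation T := (CnxCn R n).
Variable A : set T.
Hypothesis oA : open A.
Implicit Types (f g : T -> C^o) (v x y : T) (s c l : C) (i j k m : 'I_n).

Lemma rderive_near f g v x :
  (\forall t \near (0 : R), f (x + t%:C *: v) = g (x + t%:C *: v)) ->
  csmooth A g -> A x -> rderive v f x = rderive v g x.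
Proof.
move=> fg sg Ax; apply: rderiveE.
  apply: near_eq_is_derive (is_dir_Re v sg Ax).
  by apply: filterS fg => t ->.
apply: near_eq_is_derive (is_dir_Im v sg Ax).
by apply: filterS fg => t ->.
Qed.

(** A vertical derivative samples a single fiber. Coefficients that depend only on z may therefore
    be frozen at [x] before differentiating. *)
Lemma wder_fiber s (w : 'rV[C]_n) f g x :
  (forall y, A y -> y.1 = x.1 -> f y = g y) -> csmooth A g -> A x ->
  wder s ((0, w) : T) f x = wder s ((0, w) : T) g x.
Proof.
move=> fg sg Ax.
have H (u : 'rV[C]_n) : rderive ((0, u) : T) f x = rderive ((0, u) : T) g x.
  apply: rderive_near => //; apply: filterS (near_line ((0, u) : T) oA Ax) => t At.
  by apply: fg => //=; rewrite scaler0 addr0.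
have iE : 'i%C *: ((0, w) : T) = ((0, 'i%C *: w) : T).
  by congr (_, _); rewrite scaler0.
by rewrite /wder iE !H.
Qed.

(** * Fiber coordinates and their Wirtinger derivatives *)

Lemma coord_continuous2 j : continuous (fun x : T => x.2 0 j : C^o).
Proof.
move=> x.
have H1 : {for x, continuous (fun y : T => y.2 : Cn R n)} by exact: cvg_snd.
have H2 : {for (x.2 : Cn R n), continuous (fun v : Cn R n => v 0 j : C^o)}.
  exact: coord_continuous.
exact: (continuous_comp H1 H2).
Qed.

Lemma csmooth_coord j : csmooth A (fun x : T => x.2 0 j).
Proof.
split=> k.
  apply: (diffn_affine oA k (l := fun v : T => complex.Re (v.2 0 j))).
    by move=> x; apply: continuous_comp (@coord_continuous2 j x) _; exact: Re_continuous.
  by move=> x v t; rewrite !mxE; case: (x.2 0 j) (v.2 0 j) => [a b] [c d] /=; ring.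
apply: (diffn_affine oA k (l := fun v : T => complex.Im (v.2 0 j))).
  by move=> x; apply: continuous_comp (@coord_continuous2 j x) _; exact: Im_continuous.
by move=> x v t; rewrite !mxE; case: (x.2 0 j) (v.2 0 j) => [a b] [c d] /=; ring.
Qed.

Lemma csmooth_conj f : csmooth A f -> csmooth A (fun x => (f x)^*%C).
Proof.
move=> [fr fi]; split=> k.
  by have := fr k; apply: diffn_local => // x _; case: (f x).
by have := diffnN oA (fi k); apply: diffn_local => // x _; case: (f x).
Qed.

Lemma rderive_coord j v x : rderive v (fun x : T => x.2 0 j) x = v.2 0 j.
Proof.
by apply: rderiveE; apply: is_dir_affine => t; rewrite !mxE;
  case: (x.2 0 j) (v.2 0 j) => [a b] [c d] /=; ring.
Qed.

Lemma rderive_conj_coord j v x :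
  rderive v (fun x : T => (x.2 0 j)^*%C) x = (v.2 0 j)^*%C.
Proof.
by apply: rderiveE; apply: is_dir_affine => t; rewrite !mxE;
  case: (x.2 0 j) (v.2 0 j) => [a b] [c d] /=; ring.
Qed.

Lemma double_half (c : C) : (c + c) / 2 = c.
Proof. by rewrite -mulr2n -[c *+ 2]mulr_natr mulfK // pnatr_eq0. Qed.

Lemma conjc_mul c s : (c * s)^*%C = c^*%C * s^*%C.
Proof. exact: rmorphM. Qed.

Lemma conjc_i : 'i%C^*%C = - 'i%C :> C.
Proof. by apply/eqP; rewrite eq_complex /= oppr0 !eqxx. Qed.

Lemma wderN_coord j v x : wder (- 'i%C) v (fun x : T => x.2 0 j) x = v.2 0 j.
Proof.
rewrite /wder !rderive_coord mxE mulrA mulNr -expr2 sqr_i opprK mul1r.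
exact: double_half.
Qed.

Lemma wderi_coord j v x : wder 'i%C v (fun x : T => x.2 0 j) x = 0.
Proof.
by rewrite /wder !rderive_coord mxE mulrA -expr2 sqr_i mulN1r subrr mul0r.
Qed.

Lemma wderN_conj_coord j v x :
  wder (- 'i%C) v (fun x : T => (x.2 0 j)^*%C) x = 0.
Proof.
rewrite /wder !rderive_conj_coord mxE conjc_mul conjc_i mulrA mulrNN -expr2 sqr_i.
by rewrite mulN1r subrr mul0r.
Qed.

Lemma dzE k f : dz k f = wder (- 'i%C) ((delta_mx 0 k, 0) : T) f.
Proof. exact: wirtingerE. Qed.
Lemma detaE k f : deta k f = wder (- 'i%C) ((0, delta_mx 0 k) : T) f.
Proof. exact: wirtingerE. Qed.
Lemma detabarE k f : detabar k f = wder 'i%C ((0, delta_mx 0 k) : T) f.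
Proof. by []. Qed.

Lemma fiber_vectE x : ((0, x.2) : T) = \sum_j x.2 0 j *: ((0, delta_mx 0 j) : T).
Proof.
have H (r : seq 'I_n) : \sum_(j <- r) x.2 0 j *: ((0, delta_mx 0 j) : T) =
    (0, \sum_(j <- r) x.2 0 j *: delta_mx 0 j).
  elim: r => [|j r IH]; first by rewrite !big_nil.
  by rewrite !big_cons IH; congr (_, _); rewrite /= scaler0 addr0.
by rewrite H; congr (_, _); exact: row_sum_delta.
Qed.

Definition fscale l x : T := (x.1, l *: x.2).

(** A multiplier function is used because an integer degree cannot separate l from its conjugate: L
    has weight [l^*%C * l], its etabar-derivatives and the [chern_N] have weight [l], the metric
    tensor 1, and the spray [l * l]. *)
Definition homogeneous (chi : C -> C) f : Prop :=
  forall x l, A x -> l != 0 -> f (fscale l x) = chi l * f x.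

Hypothesis conicA : forall x l, A x -> l != 0 -> A (fscale l x).

Lemma homogeneous_sum chi (I : Type) (r : seq I) (P : pred I) (F : I -> T -> C^o) :
  (forall i : I, homogeneous chi (F i)) ->
  homogeneous chi (fun x => \sum_(i <- r | P i) F i x).
Proof.
by move=> hF x l Ax l0; rewrite mulr_sumr; apply: eq_bigr => i _; exact: hF.
Qed.

(** Chain rule for the dilation, applied to point and direction together. It fixes horizontal
    directions and multiplies vertical ones by [l]; thus [dz] keeps the weight, while [deta] divides
    it by [l] and [detabar] by the conjugate of [l]. *)
Lemma wder_fscale chi s v f x l : csmooth A f -> homogeneous chi f ->
  A x -> l != 0 -> wder s (fscale l v) f (fscale l x) = chi l * wder s v f x.
Proof.
move=> sf hf Ax l0.
have H w : rderive (fscale l w) f (fscale l x) = chi l * rderive w f x.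
  have -> : rderive (fscale l w) f (fscale l x) =
      rderive w (fun y => f (fscale l y)) x.
    have E t : fscale l x + t%:C *: fscale l w = fscale l (x + t%:C *: w).
      by congr (_, _); rewrite /= scalerDr !scalerA mulrC.
    rewrite /rderive /re_along /im_along.
    by congr (_ +i* _); congr (derive1 _ 0); apply/funext => t; rewrite E.
  have sc := csmooth_cst oA (chi l).
  rewrite (rderive_local (A := A) oA w _ (csmoothM oA sc sf)) //.
    by rewrite (rderiveM w sc sf) // rderive_cst mul0r add0r.
  by move=> y; rewrite inE => Ay; rewrite hf.
have iE : 'i%C *: fscale l v = fscale l ('i%C *: v).
  by congr (_, _); rewrite /= !scalerA mulrC.
by rewrite /wder iE !H mulrCA -mulrDr mulrA.
Qed.

Lemma fscale_fiber l (w : 'rV[C]_n) : fscale l (0, w) = l *: ((0, w) : T).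
Proof. by congr (_, _); rewrite /= scaler0. Qed.

Lemma homogeneous_deta chi chi' k f : (forall l, chi l = l * chi' l) ->
  csmooth A f -> homogeneous chi f -> homogeneous chi' (deta k f).
Proof.
move=> chiE sf hf x l Ax l0; rewrite detaE.
have := wder_fscale (- 'i%C) ((0, delta_mx 0 k) : T) sf hf Ax l0.
rewrite fscale_fiber (wder_scaleN oA _ _ sf (conicA Ax l0)) chiE -mulrA.
exact: mulfI.
Qed.

Lemma homogeneous_detabar chi chi' k f : (forall l, chi l = l^*%C * chi' l) ->
  csmooth A f -> homogeneous chi f -> homogeneous chi' (detabar k f).
Proof.
move=> chiE sf hf x l Ax l0; rewrite detabarE.
have := wder_fscale 'i%C ((0, delta_mx 0 k) : T) sf hf Ax l0.
rewrite fscale_fiber (wder_scalei oA _ _ sf (conicA Ax l0)) chiE -mulrA.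
by apply: mulfI; rewrite conjc_eq0.
Qed.

Lemma homogeneous_dz chi k f : csmooth A f -> homogeneous chi f ->
  homogeneous chi (dz k f).
Proof.
move=> sf hf x l Ax l0; rewrite dzE.
have := wder_fscale (- 'i%C) ((delta_mx 0 k, 0) : T) sf hf Ax l0.
by rewrite /fscale /= scaler0.
Qed.

(** Along the line x + t (0, c eta), which is a dilation by 1 + t c, each weight needed for Euler's
    identities is a polynomial in t of degree at most 2; its linear coefficient is the
    derivative. *)
Lemma rderive_quadratic f v x c s : csmooth A f -> A x ->
  (\forall t \near (0 : R), f (x + t%:C *: v) = (1 + t%:C * c + t%:C ^+ 2 * s) * f x) ->
  rderive v f x = c * f x.
Proof.
move=> sf Ax fE.
have D (a b d : R) : is_derive (0 : R) 1 (fun t : R => a + t * b + t * t * d) b.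
  have H : is_derive (0 : R) 1 (fun t : R => t) 1 by exact: is_derive_id.
  have H2 := is_deriveM H H.
  have cst (e : R) : is_derive (0 : R) 1 (fun _ : R => e) 0 by exact: is_derive_cst.
  have := is_deriveD (is_deriveD (cst a) (is_deriveM H (cst b))) (is_deriveM H2 (cst d)).
  by rewrite /GRing.scale /= !(mul0r, mulr0, addr0, add0r, mulr1).
have polyE (z : C) (t : R) : (1 + t%:C * c + t%:C ^+ 2 * s) * z =
   (complex.Re z + t * complex.Re (c * z) + t * t * complex.Re (s * z)) +i*
   (complex.Im z + t * complex.Im (c * z) + t * t * complex.Im (s * z)).
  rewrite expr2; case: z c s {fE} => [a b] [p q] [p' q'].
  by apply/eqP; rewrite eq_complex /=; apply/andP; split; apply/eqP; ring.
apply: rderiveE.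
  apply: near_eq_is_derive (D (complex.Re (f x)) _ (complex.Re (s * f x))).
  by apply: filterS fE => t ->; rewrite polyE.
apply: near_eq_is_derive (D (complex.Im (f x)) _ (complex.Im (s * f x))).
by apply: filterS fE => t ->; rewrite polyE.
Qed.

Lemma line_fscale x (t : R) c :
  x + t%:C *: ((0, c *: x.2) : T) = fscale (1 + t%:C * c) x.
Proof.
by congr (_, _); rewrite /= ?scaler0 ?addr0 // scalerA -[X in X + _]scale1r -scalerDl.
Qed.

Lemma near_unit c : \forall t \near (0 : R), 1 + t%:C * c != 0.
Proof.
have := @line_continuous R C^o 1 c 0.
rewrite /continuous_at scale0r addr0 => H.
exact: cvgr_neq0 H (oner_neq0 _).
Qed.

(** The derivative along c eta is [c * f x]. Taking c = 1 and c = i, the holomorphic combination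
    gives (f + f) / 2. *)
Lemma euler f x : csmooth A f -> homogeneous id f -> A x ->
  \sum_j deta j f x * x.2 0 j = f x.
Proof.
move=> sf hf Ax.
have D c : rderive ((0, c *: x.2) : T) f x = c * f x.
  apply: (@rderive_quadratic _ _ _ _ 0) => //; apply: filterS (near_unit c) => t t0.
  by rewrite line_fscale hf // mulr0 addr0.
have -> : \sum_j deta j f x * x.2 0 j = wder (- 'i%C) ((0, x.2) : T) f x.
  rewrite fiber_vectE (wder_sumv oA) //; apply: eq_bigr => j _.
  by rewrite (wder_scaleN oA) // detaE mulrC.
rewrite /wder.
have -> : 'i%C *: ((0, x.2) : T) = ((0, 'i%C *: x.2) : T).
  by congr (_, _); rewrite scaler0.
rewrite -{1}[x.2]scale1r !D mul1r mulrA mulNr -expr2 sqr_i opprK mul1r.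
exact: double_half.
Qed.

(** Here the derivative along c eta is [(c + c^*%C) * f x]: twice [f x] for c = 1 and zero for c =
    i. *)
Lemma euler_conj f x : csmooth A f -> homogeneous (fun l => l^*%C * l) f -> A x ->
  \sum_j detabar j f x * (x.2 0 j)^*%C = f x.
Proof.
move=> sf hf Ax.
have D c : rderive ((0, c *: x.2) : T) f x = (c + c^*%C) * f x.
  apply: (@rderive_quadratic _ _ _ _ (c^*%C * c)) => //.
  apply: filterS (near_unit c) => t t0; rewrite line_fscale hf //; congr (_ * _).
  have -> : (1 + t%:C * c)^*%C = 1 + t%:C * c^*%C.
    case: c {t0} => p q; apply/eqP; rewrite eq_complex /=.
    by apply/andP; split; apply/eqP; ring.
  ring.
have -> : \sum_j detabar j f x * (x.2 0 j)^*%C = wder 'i%C ((0, x.2) : T) f x.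
  rewrite fiber_vectE (wder_sumv oA) //; apply: eq_bigr => j _.
  by rewrite (wder_scalei oA) // detabarE mulrC.
rewrite /wder.
have -> : 'i%C *: ((0, x.2) : T) = ((0, 'i%C *: x.2) : T).
  by congr (_, _); rewrite scaler0.
rewrite -{1}[x.2]scale1r !D conjc1.
by rewrite conjc_i subrr mul0r mulr0 addr0 mulrDl mul1r double_half.
Qed.

End FiberCalculus.

(** * Chern-Finsler and Berwald coefficients *)

Lemma sum_mul_delta (K : pzSemiRingType) n (a : 'I_n -> K) k :
  \sum_j a j * (j == k)%:R = a k.
Proof.
rewrite (bigD1 k) //= eqxx mulr1 big1 ?addr0 // => j /negPf ->.
by rewrite mulr0.
Qed.

Section ChernFinsler.
Context {R : realType} {n : nat}.
Local Notation C := (R[i]).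
Local Notation T := (CnxCn R n).
Variables (A : set T) (F : T -> C^o).
Local Notation L := (lagrangian F).
Local Notation g := (metric_tensor F).
Hypothesis oA : open A.
Hypothesis conicA : forall x l, A x -> l != 0 -> A (fscale l x).
Hypothesis sL : csmooth A L.
Hypothesis hL : homogeneous A (fun l => l^*%C * l) L.
Hypothesis unit_g : forall x, A x -> g x \in unitmx.
Implicit Types (x y : T) (i j k l m : 'I_n).

Opaque wder dz deta detabar.

Lemma csmooth_detabarL m : csmooth A (detabar m L).
Proof. by rewrite detabarE; exact: csmooth_wder. Qed.

Lemma csmooth_deta k f : csmooth A f -> csmooth A (deta k f).
Proof. by rewrite detaE; exact: csmooth_wder. Qed.

Lemma csmooth_dz k f : csmooth A f -> csmooth A (dz k f).
Proof. by rewrite dzE; exact: csmooth_wder. Qed.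

Lemma detabar_deta_comm m k f x : csmooth A f -> A x ->
  detabar m (deta k f) x = deta k (detabar m f) x.
Proof. by move=> sf Ax; rewrite !detaE !detabarE; exact: (wder_comm oA). Qed.

Lemma detabar_dz_comm m k f x : csmooth A f -> A x ->
  detabar m (dz k f) x = dz k (detabar m f) x.
Proof. by move=> sf Ax; rewrite !dzE !detabarE; exact: (wder_comm oA). Qed.

Lemma homogeneous_detabarL m : homogeneous A id (detabar m L).
Proof. exact: (homogeneous_detabar oA conicA (chi' := id) m (fun=> erefl) sL hL). Qed.

Lemma metricE l m : (fun x => g x l m) = deta l (detabar m L).
Proof. by apply/funext => x; rewrite mxE. Qed.

Lemma metric_tensorE x l m : g x l m = deta l (detabar m L) x.
Proof. by rewrite mxE. Qed.

Opaque metric_tensor.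

Lemma deta_coord j k x : deta k (fun y : T => y.2 0 j) x = (j == k)%:R.
Proof. by rewrite detaE wderN_coord mxE eqxx. Qed.

Lemma dz_coord j k x : dz k (fun y : T => y.2 0 j) x = 0.
Proof. by rewrite dzE wderN_coord mxE. Qed.

Lemma csmooth_metric l m : csmooth A (fun x => g x l m).
Proof. by rewrite metricE; apply/csmooth_deta/csmooth_detabarL. Qed.

Lemma homogeneous_metric l m : homogeneous A (fun=> 1) (fun x => g x l m).
Proof.
rewrite metricE; apply: (homogeneous_deta oA conicA (chi := id)).
- by move=> c; rewrite mulr1.
- exact: csmooth_detabarL.
- exact: homogeneous_detabarL.
Qed.

Lemma csmooth_chern_N i k : csmooth A (chern_N F i k).
Proof.
apply: csmooth_sum => // m; apply: csmooth_sum => // l.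
apply: csmoothM => //; last exact: csmooth_coord.
apply: csmoothM => //; last exact/csmooth_dz/csmooth_metric.
exact: (csmooth_invmx oA csmooth_metric unit_g).
Qed.

Lemma homogeneous_chern_N i k : homogeneous A id (chern_N F i k).
Proof.
apply: homogeneous_sum => m; apply: homogeneous_sum => l x c Ax c0.
have -> : g (fscale c x) = g x.
  by apply/matrixP => p q; have := homogeneous_metric p q Ax c0; rewrite mul1r.
have -> := homogeneous_dz oA k (csmooth_metric l m) (homogeneous_metric l m) Ax c0.
by rewrite mul1r mxE mulrCA.
Qed.

Lemma csmooth_spray i : csmooth A (spray F i).
Proof.
apply: csmoothM => //; first exact: csmooth_cst.
apply: csmooth_sum => // j; apply: csmoothM => //; last exact: csmooth_coord.
exact: csmooth_chern_N.
Qed.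

Lemma homogeneous_deta_spray i k : homogeneous A id (deta k (spray F i)).
Proof.
apply: (homogeneous_deta oA conicA (chi := fun c => c * c)) => //.
  exact: csmooth_spray.
move=> x c Ax c0; rewrite /spray [RHS]mulrCA; congr (_ * _).
rewrite mulr_sumr; apply: eq_bigr => j _.
by have -> := homogeneous_chern_N i j Ax c0; rewrite mxE mulrACA.
Qed.

(** Differentiate Euler's identity for L in the etabar variables: the conjugate coordinates are
    annihilated by holomorphic derivatives. With [v] left free, this serves both [deta] and [dz]. *)
Lemma wderN_lagrangian v x : A x ->
  wder (- 'i%C) v L x = \sum_l wder (- 'i%C) v (detabar l L) x * (x.2 0 l)^*%C.
Proof.
move=> Ax; have sc l := csmooth_conj oA (csmooth_coord oA l).
have sM l := csmoothM oA (csmooth_detabarL l) (sc l).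
have LE : {in A, (fun y => \sum_l detabar l L y * (y.2 0 l)^*%C) =1 L}.
  by move=> y; rewrite inE => Ay; have H := euler_conj oA sL hL Ay; exact: H.
rewrite (wder_local oA _ _ LE (csmooth_sum oA _ _ sM) Ax) (wder_sum oA _ _ _ _ sM Ax).
apply: eq_bigr => l _; rewrite (wderM _ _ (csmooth_detabarL l) (sc l) Ax).
by rewrite wderN_conj_coord mulr0 addr0.
Qed.

Lemma metric_mul_conj_eta i x : A x ->
  \sum_l g x i l * (x.2 0 l)^*%C = deta i L x.
Proof.
move=> Ax; rewrite (detaE i L) wderN_lagrangian //; apply: eq_bigr => l _.
by rewrite metric_tensorE detaE.
Qed.

(** [detabar m L] has weight [l], so Euler recovers it from the metric contracted with eta, and eta
    is constant for [dz k]. *)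
Lemma dz_metric_mul_eta k m x : A x ->
  \sum_l dz k (fun y => g y l m) x * x.2 0 l = dz k (detabar m L) x.
Proof.
move=> Ax; have sg l := csmooth_metric l m; have sc l := csmooth_coord oA l.
have sM l := csmoothM oA (sg l) (sc l).
have E : {in A, (fun y => \sum_l g y l m * y.2 0 l) =1 detabar m L}.
  move=> y; rewrite inE => Ay.
  rewrite -[RHS](euler oA (csmooth_detabarL m) (homogeneous_detabarL m) Ay).
  by apply: eq_bigr => l _; rewrite metric_tensorE.
rewrite (dzE k (detabar m L)) (wder_local oA _ _ E (csmooth_sum oA _ _ sM) Ax).
rewrite (wder_sum oA _ _ _ _ sM Ax); apply: eq_bigr => l _.
by rewrite (wderM _ _ (sg l) (sc l) Ax) -!dzE dz_coord mulr0 addr0.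
Qed.

Lemma chern_N_metric k m x : A x ->
  \sum_i chern_N F i k x * g x i m = dz k (detabar m L) x.
Proof.
move=> Ax; pose w : 'rV[C]_n := \row_p dz k (detabar p L) x.
have NE i : chern_N F i k x = (w *m invmx (g x)) 0 i.
  rewrite mxE; apply: eq_bigr => p _; rewrite mxE -dz_metric_mul_eta // mulr_suml.
  by apply: eq_bigr => l _; rewrite -mulrA mulrC.
transitivity ((w *m invmx (g x) *m g x) 0 m).
  by rewrite mxE; apply: eq_bigr => i _; rewrite NE.
by rewrite mulmxKV ?unit_g // mxE.
Qed.

(** This is [chern_N_metric] contracted with the conjugate of eta: the metric becomes L_i on the
    left, and [wderN_lagrangian] collapses the right. *)
Lemma deta_L_chern_N k x : A x ->
  \sum_i deta i L x * chern_N F i k x = dz k L x.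
Proof.
move=> Ax.
rewrite (dzE k L) wderN_lagrangian //.
transitivity (\sum_i \sum_l chern_N F i k x * g x i l * (x.2 0 l)^*%C).
  apply: eq_bigr => i _; rewrite -metric_mul_conj_eta // mulr_suml.
  by apply: eq_bigr => l _; rewrite mulrC mulrA.
rewrite exchange_big; apply: eq_bigr => l _.
by rewrite -dzE -chern_N_metric // mulr_suml.
Qed.

Opaque chern_N.

Lemma chern_L_mul_eta i k x : A x ->
  \sum_j chern_L F i j k x * x.2 0 j = chern_N F i k x.
Proof. exact: (euler oA (csmooth_chern_N i k) (homogeneous_chern_N i k)). Qed.

Lemma chern_LE i j k : chern_L F i j k = deta j (chern_N F i k).
Proof. by []. Qed.

Opaque chern_L.

(** Differentiating 2 G^i = N^i_j eta^j in eta^k gives 2 G^i_k = L^i_{kj} eta^j + N^i_k, whereas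
    Euler gives N^i_k = L^i_{jk} eta^j. Subtracting produces the factor 2. *)
Lemma torsion_mul_eta i k x : A x ->
  \sum_j torsion F i j k x * x.2 0 j = 2 * (chern_N F i k x - deta k (spray F i) x).
Proof.
move=> Ax; have sN j := csmooth_chern_N i j; have sc l := csmooth_coord oA l.
have sM j : csmooth A (fun y => chern_N F i j y * y.2 0 j) by exact: csmoothM.
have -> : deta k (spray F i) x =
    2^-1 * (\sum_j chern_L F i k j x * x.2 0 j + chern_N F i k x).
  rewrite (detaE k (spray F i)) (wderM (A := A)) //; first last.
  - exact: csmooth_sum.
  - exact: csmooth_cst.
  rewrite wder_cst mul0r add0r (wder_sum oA) //; congr (_ * _).
  under eq_bigr => j _ do rewrite (wderM (A := A)) // -!detaE deta_coord.
  rewrite big_split /=; congr (_ + _).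
  exact: sum_mul_delta.
rewrite mulrBr mulVKf ?pnatr_eq0 // -(chern_L_mul_eta i k Ax).
transitivity (\sum_j chern_L F i j k x * x.2 0 j - \sum_j chern_L F i k j x * x.2 0 j).
  by rewrite -sumrB; apply: eq_bigr => j _; rewrite mulrBl.
have E (c d : C) : c - d = 2 * c - (d + c) by ring.
exact: E.
Qed.

(** The four conditions are restated in one chart; each global notion quantifies over the charts, so
    the equivalence can be settled chart by chart. *)
Definition local_kahler := forall x i k, A x ->
  \sum_j torsion F i j k x * x.2 0 j = 0.
Definition local_weakly_kahler := forall x k, A x ->
  \sum_i \sum_l \sum_j
    g x i l * torsion F i j k x * x.2 0 j * ((x.2 0 l)^*)%R = 0.
Definition local_chern_L_basic := forall i j k, depends_only_on_z A (chern_L F i j k).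
Definition local_berwald_L_basic := forall i j k, depends_only_on_z A (berwald_L F i j k).

Lemma chern_N_kahler : local_kahler <->
  forall i k x, A x -> chern_N F i k x = deta k (spray F i) x.
Proof.
split=> [K i k x Ax|K x i k Ax]; last by rewrite torsion_mul_eta // K // subrr mulr0.
apply/subr0_eq/(mulfI (_ : 2 != 0 :> C)); first by rewrite pnatr_eq0.
by rewrite mulr0 -torsion_mul_eta // K.
Qed.

(** Contracting the torsion with eta gives 2 (N^i_k - G^i_k), and contracting the metric with the
    conjugate of eta gives L_i; then L_i N^i_k is d_k L. *)
Lemma weakly_kahlerE : local_weakly_kahler <->
  forall k x, A x -> dz k L x = \sum_i deta i L x * deta k (spray F i) x.
Proof.
have E k x : A x -> \sum_i \sum_l \sum_j
    g x i l * torsion F i j k x * x.2 0 j * ((x.2 0 l)^*)%R =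
    2 * (dz k L x - \sum_i deta i L x * deta k (spray F i) x).
  move=> Ax; rewrite -deta_L_chern_N // -sumrB mulr_sumr; apply: eq_bigr => i _.
  transitivity ((\sum_l g x i l * (x.2 0 l)^*%C) * \sum_j torsion F i j k x * x.2 0 j).
    rewrite mulr_suml; apply: eq_bigr => l _; rewrite mulr_sumr; apply: eq_bigr => j _.
    by rewrite -[LHS]mulrA -[LHS]mulrA [LHS]mulrCA !mulrA; ring.
  by rewrite metric_mul_conj_eta // torsion_mul_eta //; ring.
split=> [W k x Ax|W x k Ax]; last by rewrite E // W // subrr mulr0.
apply/subr0_eq/(mulfI (_ : 2 != 0 :> C)); first by rewrite pnatr_eq0.
by rewrite mulr0 -E // W.
Qed.

(** Differentiate N^i_k = G^i_k in eta^j. The lower indices appear exchanged because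
    [berwald_L F i k j] differentiates in eta^k first. *)
Lemma chern_L_berwald_L : (forall i k x, A x -> chern_N F i k x = deta k (spray F i) x) ->
  forall i j k x, A x -> chern_L F i j k x = berwald_L F i k j x.
Proof.
move=> K i j k x Ax; rewrite chern_LE /berwald_L !(detaE j).
apply: (wder_local oA) => //; last exact/csmooth_deta/csmooth_spray.
by move=> y; rewrite inE => Ay; rewrite K.
Qed.

Lemma kahler_weakly_kahler : local_kahler -> local_weakly_kahler.
Proof.
move=> /chern_N_kahler K; apply/weakly_kahlerE => k x Ax.
by rewrite -deta_L_chern_N //; apply: eq_bigr => i _; rewrite K.
Qed.

(* By Euler's identity [deta k (spray F i)] is linear in eta. *)
Lemma detabar_deta_spray : local_berwald_L_basic ->
  forall i k m x, A x -> detabar m (deta k (spray F i)) x = 0.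
Proof.
move=> B i k m x Ax; have sc l := csmooth_coord oA l.
have sb c := csmooth_cst oA c.
have sM j := csmoothM oA (sb (berwald_L F i k j x)) (sc j).
pose f y : C^o := \sum_j berwald_L F i k j x * y.2 0 j.
have fE y : A y -> y.1 = x.1 -> deta k (spray F i) y = f y.
  move=> Ay yx; have sG := csmooth_deta k (csmooth_spray i).
  have bE j : deta j (deta k (spray F i)) y = berwald_L F i k j x.
    case: x y Ax Ay yx {sM f} => [z e] [z' e'] Ax Ay /= E.
    by rewrite E in Ay *; exact: (B i k j z e' e Ay Ax).
  rewrite -(euler oA sG (homogeneous_deta_spray i k) Ay) /f.
  by apply: eq_bigr => j _; rewrite bE.
rewrite detabarE (wder_fiber oA _ _ fE (csmooth_sum oA _ _ sM) Ax).
rewrite (wder_sum oA _ _ _ _ sM Ax) big1 // => j _.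
rewrite (wderM _ _ (sb _) (sc j) Ax).
by rewrite wder_cst mul0r add0r wderi_coord mulr0.
Qed.

(* Applying [detabar m] to [dz k L = deta i L * deta k G^i] and commuting
   derivatives gives [N^i_k g_{i m} = deta k G^i * g_{i m}]. *)
Lemma weakly_kahler_kahler :
  local_berwald_L_basic -> local_weakly_kahler -> local_kahler.
Proof.
move=> B /weakly_kahlerE W; apply/chern_N_kahler => i k x Ax.
have sG p : csmooth A (deta k (spray F p)) by exact/csmooth_deta/csmooth_spray.
have sdL p : csmooth A (deta p L) by exact: csmooth_deta.
have sM p : csmooth A (fun y => deta p L y * deta k (spray F p) y) by exact: csmoothM.
pose u : 'rV[C]_n := \row_p chern_N F p k x.
pose w : 'rV[C]_n := \row_p deta k (spray F p) x.
suff /(congr1 (fun v => (v *m invmx (g x)) 0 i)) : u *m g x = w *m g x.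
  by rewrite !mulmxK ?unit_g // !mxE.
apply/rowP => m; rewrite !mxE.
under eq_bigr => p _ do rewrite mxE.
under [RHS]eq_bigr => p _ do rewrite mxE.
rewrite chern_N_metric // -detabar_dz_comm // detabarE.
have LE : {in A, (fun y => \sum_p deta p L y * deta k (spray F p) y) =1 dz k L}.
  by move=> y; rewrite inE => Ay; rewrite W.
rewrite (wder_local oA _ _ LE (csmooth_sum oA _ _ sM) Ax).
rewrite (wder_sum oA _ _ _ _ sM Ax); apply: eq_bigr => p _.
rewrite (wderM _ _ (sdL p) (sG p) Ax) metric_tensorE -detabar_deta_comm //.
have -> : wder 'i%C ((0, delta_mx 0 m) : T) (deta k (spray F p)) x = 0.
  exact: detabar_deta_spray.
by rewrite mulr0 addr0 mulrC.
Qed.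

Lemma berwald_iff : local_kahler /\ local_chern_L_basic <->
  local_berwald_L_basic /\ local_weakly_kahler.
Proof.
split=> [[K Lz]|[B W]].
  split; last exact: kahler_weakly_kahler.
  have E := chern_L_berwald_L (chern_N_kahler.1 K).
  move=> i j k z e e' Ae Ae'; rewrite -(E i k j _ Ae) -(E i k j _ Ae').
  exact: Lz Ae Ae'.
have K := weakly_kahler_kahler B W; split; first exact: K.
move=> i j k z e e' Ae Ae'.
have E := chern_L_berwald_L (chern_N_kahler.1 K).
by rewrite (E i j k _ Ae) (E i j k _ Ae'); exact: B Ae Ae'.
Qed.

End ChernFinsler.

(** * Randers metrics *)

(** A nonzero vector in the left kernel would make the Hermitian form vanish. *)
Lemma posdefmx_unit (R : realType) n (G : 'M[R[i]]_n) : posdefmx G -> G \in unitmx.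
Proof.
move=> [_ Gpos]; rewrite -row_free_unit -kermx_eq0; apply/negPn/negP => /rowV0Pn[v].
move=> /sub_kermxP vG v0; have := Gpos v v0.
by rewrite vG mul0mx mxE ltxx.
Qed.

Section RandersDomain.
Context {R : realType} {n : nat} (M : complexManifold R n) (b : form10 M).
Variable c : chart_index M.

Lemma randers_beta_continuous (x : CnxCn R n) : chart_cod (atlas c) x.1 ->
  {for x, continuous (randers_beta b c)}.
Proof.
move=> cx; pose f i (y : CnxCn R n) : R[i]^o := b c y.1 0 i * y.2 0 i.
have fc i : {for x, continuous (f i)}.
  have H1 : {for x, continuous (fun y : CnxCn R n => y.1 : Cn R n)} by exact: cvg_fst.
  (* The empty list of directions in [smooth_on] yields plain continuity of the components of
     [b]. *)
  have H2 := continuous_comp H1 (form_smooth b i [::] cx).1.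
  exact: cvgM H2 (@coord_continuous2 R n i x).
suff H (r : seq 'I_n) : {for x, continuous (fun y => \sum_(i <- r) f i y : R[i]^o)}.
  exact: H.
elim: r => [|i r IH].
  rewrite (_ : (fun y => _) = fun=> 0); first exact: cvg_cst.
  by apply/funext => y; rewrite big_nil.
rewrite (_ : (fun y => _) = fun y => f i y + \sum_(j <- r) f j y).
  exact: cvgD (fc i) IH.
by apply/funext => y; rewrite big_cons.
Qed.

Lemma randers_dom_open : open (randers_dom b c).
Proof.
rewrite openE => x [cx x0 bx]; rewrite /interior.
have H1 : \forall y \near x, chart_cod (atlas c) y.1.
  have H : {for x, continuous (fun y : CnxCn R n => y.1 : Cn R n)} by exact: cvg_fst.
  by apply: H; apply: open_nbhs_nbhs; split=> //; exact: chart_cod_open.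
have H2 := cvgr_neq0 _ (randers_beta_continuous cx) bx.
apply: filterS2 H1 (H2 _) => y cy by0; split=> //.
(* Contrapositive: beta vanishes on the zero vector. *)
apply: contraNneq by0 => y0; apply/eqP.
by rewrite /randers_beta big1 // => i _; rewrite y0 mxE mulr0.
Qed.

Lemma randers_dom_conic x (l : R[i]) : randers_dom b c x -> l != 0 ->
  randers_dom b c (fscale l x).
Proof.
move=> [cx x0 bx] l0; split=> //=; first by rewrite scaler_eq0 negb_or l0.
have -> : randers_beta b c (fscale l x) = l * randers_beta b c x.
  by rewrite /randers_beta mulr_sumr; apply: eq_bigr => i _; rewrite mxE mulrCA.
by rewrite mulf_neq0.
Qed.

End RandersDomain.

Theorem theorem4p3 (R : realType) (n : nat) (M : complexManifold R n)
    (a : hermitianMetric M) (b : form10 M)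
    (hM : connected [set: M]) (hF : complex_randers a b) :
  let F := randers_metric a b in
  let D := randers_dom b in
  complex_berwald F D <-> generalized_berwald F D /\ weakly_kahler F D.
Proof.
move=> F D.
have H c : local_kahler (D c) (F c) /\ local_chern_L_basic (D c) (F c) <->
    local_berwald_L_basic (D c) (F c) /\ local_weakly_kahler (D c) (F c).
  apply: berwald_iff.
  - exact: randers_dom_open.
  - exact: randers_dom_conic.
  - by apply: smooth_on_csmooth; exact: (finsler_smooth hF (c := c)).
  - move=> [z eta] l [/= cz _ _] _; rewrite /lagrangian.
    have -> : F c (fscale l (z, eta)) = `|l| * F c (z, eta).
      exact: (finsler_homogeneous hF eta l cz).
    (* Squaring [|l|] gives L the weight [l^*%C * l]. *)
    by rewrite exprMn sqr_normc [l * _]mulrC.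
  - by move=> x Dx; apply/posdefmx_unit/(finsler_posdef hF).
split=> [[K Lz]|[B W]].
  by split=> c; have [] := (H c).1 (conj (K c) (Lz c)).
by split=> c; have [] := (H c).2 (conj (B c) (W c)).
Qed.
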